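(* Let $(X,\rho)$ be a $\rho$-complete controlled rectangular $b$-metric space with control function $\theta:X^4\to[1,\infty)$, and let $T:X\to X$ be a self-mapping. Suppose there exists $k$ with $0<k<\frac12$ such that $$\rho(Tx,Ty)\le k\,[\rho(x,Tx)+\rho(y,Ty)]\quad\text{for all } x,y\in X.$$ Suppose also that for every $x_0\in X$ the sequence $x_n=T^n x_0$ ($n\ge 0$) satisfies $$\sup_{m>1}\ \lim_{n\to\infty}\theta(x_n,x_{n+1},x_{n+2},x_m)\le \frac1k$$ and, for all $u,v\in X$, $$\lim_{n\to\infty}\theta(u,v,x_n,x_{n+1})\le 1$$ (where all the limits are assumed to exist). Then $T$ has a unique fixed point in $X$.
   Context: Controlled rectangular $b$-metric space: let $X$ be a nonempty set, $\theta:X^4\to[1,\infty)$ and $\rho:X^2\to[0,\infty)$ functions. $(X,\rho)$ is a controlled rectangular $b$-metric space (with control function $\theta$) if (1) for all $x,y\in X$, $\rho(x,y)=0$ if and only if $x=y$; (2) for all $x,y\in X$, $\rho(x,y)=\rho(y,x)$; (3) for all pairwise distinct $x,y,u,v\in X$, $\rho(x,y)\le\theta(x,y,u,v)\,[\rho(x,u)+\rho(u,v)+\rho(v,y)]$. A sequence $\{x_n\}$ in $X$ is $\rho$-Cauchy if $\lim_{n,m\to\infty}\rho(x_n,x_m)$ exists and is finite. The space is $\rho$-complete if for every $\rho$-Cauchy sequence $\{x_n\}$ in $X$ there exists $\nu\in X$ with $\lim_{n\to\infty}\rho(x_n,\nu)=\lim_{n,m\to\infty}\rho(x_n,x_m)=\rho(\nu,\nu)$.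 *)

(* Defs.v *)
From mathcomp Require Import all_boot all_order all_algebra.
From mathcomp Require Import all_classical all_reals all_analysis.
Set Implicit Arguments.
Unset Strict Implicit.
Unset Printing Implicit Defensive.
Import Order.TTheory GRing.Theory Num.Theory numFieldNormedType.Exports.
Local Open Scope classical_set_scope.
Local Open Scope ring_scope.

Record controlled_rect_bmetric (R : realType) (X : Type)
    (theta : X -> X -> X -> X -> R) (rho : X -> X -> R) : Prop := {
  crb_nonempty : inhabited X;
  crb_theta_ge1 : forall x y u v, 1 <= theta x y u v;
  crb_rho_ge0 : forall x y, 0 <= rho x y;
  crb_rho_eq0 : forall x y, rho x y = 0 <-> x = y;
  crb_rhoC : forall x y, rho x y = rho y x;
  crb_rect : forall x y u v,
    x <> y -> x <> u -> x <> v -> y <> u -> y <> v -> u <> v ->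
    rho x y <= theta x y u v * (rho x u + rho u v + rho v y)
}.

(* lim_{n,m -> oo} rho(x_n, x_m) = l, jointly in (n, m). *)
Definition double_lim (R : realType) (X : Type) (rho : X -> X -> R)
    (x : nat -> X) (l : R) : Prop :=
  rho (x nm.1) (x nm.2) @[nm --> (\oo, \oo)] --> l.

Definition rho_cauchy (R : realType) (X : Type) (rho : X -> X -> R)
    (x : nat -> X) : Prop :=
  exists l : R, double_lim rho x l.

Definition rho_complete (R : realType) (X : Type) (rho : X -> X -> R) : Prop :=
  forall x : nat -> X, rho_cauchy rho x ->
    exists nu : X,
      rho (x n) nu @[n --> \oo] --> rho nu nu /\ double_lim rho x (rho nu nu).

(* Main.v *)
(* Along an orbit x_n the displacements d_n := rho(x_n, x_{n+1}) satisfy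
   d_{n+1} <= (k / (1 - k)) d_n, so d_n -> 0, and the Kannan condition
   rho(x_{n+1}, x_{m+1}) <= k (d_n + d_m) alone makes the orbit Cauchy: the
   rectangular inequality is used only to show that its limit nu is fixed.
   If T had no fixed point, nu and T nu would have positive displacement, so
   nu, T nu, x_n, x_{n+1} would be pairwise distinct for large n, and the
   rectangular inequality would force rho(nu, T nu) <= k rho(nu, T nu) in the
   limit. *)
Require Import Defs.
From mathcomp Require Import all_boot all_order all_algebra.
From mathcomp Require Import all_classical all_reals all_analysis.
From mathcomp Require Import lra.
Set Implicit Arguments.
Unset Strict Implicit.
Unset Printing Implicit Defensive.
Import Order.TTheory GRing.Theory Num.Theory numFieldNormedType.Exports.
Local Open Scope classical_set_scope.
Local Open Scope ring_scope.

Section KannanMap.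
Variables (R : realType) (X : Type) (theta : X -> X -> X -> X -> R).
Variables (rho : X -> X -> R) (T : X -> X) (k : R).
Hypothesis hX : controlled_rect_bmetric theta rho.
Hypotheses (hk0 : 0 < k) (hk2 : k < 1 / 2).
Hypothesis hT :
  forall x y : X, rho (T x) (T y) <= k * (rho x (T x) + rho y (T y)).

Let rho_ge0 x y : 0 <= rho x y.
Proof. exact: crb_rho_ge0 hX x y. Qed.

Let onemk_gt0 : 0 < 1 - k.
Proof. by move: hk2; lra. Qed.

Let ratio_ge0 : 0 <= k / (1 - k).
Proof. by rewrite divr_ge0// ltW. Qed.

(** The bound [k < 1 / 2] says precisely that [k < 1 - k]. *)
Let ratio_lt1 : k / (1 - k) < 1.
Proof. by rewrite ltr_pdivrMr//; move: hk2; lra. Qed.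

(** The Kannan condition at [x] and [T x] has the left-hand side again on its right, with factor
    [k]; solving for it gives the ratio. *)
Lemma kannan_displacement_contract x :
  rho (T x) (T (T x)) <= k / (1 - k) * rho x (T x).
Proof.
by rewrite mulrAC ler_pdivlMr// mulrBr mulr1 lerBlDr [_ * k]mulrC -mulrDr hT.
Qed.

Lemma kannan_displacement_iter x n :
  rho (iter n T x) (iter n.+1 T x) <= (k / (1 - k)) ^+ n * rho x (T x).
Proof.
elim: n => [|n IHn]; first by rewrite expr0 mul1r.
apply: (le_trans (kannan_displacement_contract _)).
by rewrite exprS -[leRHS]mulrA ler_wpM2l.
Qed.

Lemma kannan_displacement_cvg0 x :
  rho (iter n T x) (iter n.+1 T x) @[n --> \oo] --> (0 : R).
Proof.
have cvg0 : (k / (1 - k)) ^+ n * rho x (T x) @[n --> \oo] --> (0 : R).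
  rewrite -[X in _ --> X](mul0r (rho x (T x))).
  apply: cvgMl; apply: cvg_expr.
  by rewrite ger0_norm.
apply: (squeeze_cvgr _ (cvg_cst 0) cvg0).
by apply: nearW => n; rewrite rho_ge0 kannan_displacement_iter.
Qed.

(** Starting at [T x] makes every term an image under [T], so the Kannan condition bounds each
    distance by [k] times two displacements of the orbit of [x]. *)
Lemma kannan_orbit_double_lim0 x :
  double_lim rho (fun n => iter n T (T x)) 0.
Proof.
have d0 := kannan_displacement_cvg0 x.
have cvg0 : k * (rho (iter nm.1 T x) (iter nm.1.+1 T x)
                 + rho (iter nm.2 T x) (iter nm.2.+1 T x))
              @[nm --> (\oo, \oo)] --> (0 : R).
  rewrite -[X in _ --> X](mulr0 k) -[X in k * X]addr0.
  apply: cvgMr; apply: cvgD.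
    exact: (cvg_comp fst _ cvg_fst d0).
  exact: (cvg_comp snd _ cvg_snd d0).
apply: (squeeze_cvgr _ (cvg_cst 0) cvg0).
by apply: nearW => -[n m] /=; rewrite rho_ge0 -!iterSr/= hT.
Qed.

(** Fixed points have zero displacement, so the Kannan bound on their distance is 0. *)
Lemma kannan_fixpoint_unique x y : T x = x -> T y = y -> x = y.
Proof.
move=> Tx Ty; apply/(crb_rho_eq0 hX)/eqP.
have rho0 z : rho z z = 0 by apply/(crb_rho_eq0 hX).
rewrite eq_le rho_ge0 andbT.
by have := hT x y; rewrite Tx Ty !rho0 addr0 mulr0.
Qed.

(** The conclusion is only existential because the contradiction assumes that [T] has no fixed point
    at all: [T nu] must have positive displacement too. *)
Lemma kannan_orbit_limit_fixed x nu :
    (forall x u v : X,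
       cvgn (fun n : nat => theta u v (iter n T x) (iter n.+1 T x))) ->
    (forall x u v : X,
       limn (fun n : nat => theta u v (iter n T x) (iter n.+1 T x)) <= 1) ->
    rho (iter n T x) nu @[n --> \oo] --> (0 : R) ->
  exists z, T z = z.
Proof.
move=> hcvg hlim xnu; apply: contrapT => nofix.
have Tneq z : T z <> z by move=> Tz; apply: nofix; exists z.
have disp_gt0 z : 0 < rho z (T z).
  rewrite lt_neqAle rho_ge0 andbT eq_sym; apply/eqP.
  by move=> /(crb_rho_eq0 hX)/esym/Tneq.
have d0 := kannan_displacement_cvg0 x.
set D := rho nu (T nu).
have D0 : 0 < D := disp_gt0 nu.
(* With [theta < 3 / 2] and the two small distances below [D / 36], the final estimate is [D < 3/2 *
   (D/36 + D/36 + (D/36 + D)/2) = 41/48 * D]. *)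
have e0 : 0 < D / 36 by lra.
have d_small e : 0 < e ->
    \forall n \near \oo, rho (iter n T x) (iter n.+1 T x) < e.
  by move=> ?; apply: cvgr_lt d0 _ _.
have xnu_small : \forall n \near \oo, rho (iter n T x) nu < D / 36.
  exact: cvgr_lt xnu _ e0.
have theta_lt : \forall n \near \oo,
    theta nu (T nu) (iter n T x) (iter n.+1 T x) < 3 / 2.
  apply: cvgr_lt (hcvg x nu (T nu)) _ _.
  by apply: le_lt_trans (hlim x nu (T nu)) _; lra.
have [n [dn dnu dTnu xn thn]] : exists n,
    [/\ rho (iter n T x) (iter n.+1 T x) < D / 36,
        rho (iter n T x) (iter n.+1 T x) < D,
        rho (iter n T x) (iter n.+1 T x) < rho (T nu) (T (T nu)),
        rho (iter n T x) nu < D / 36 &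
        theta nu (T nu) (iter n T x) (iter n.+1 T x) < 3 / 2].
  apply: (@filter_ex _ \oo).
  near=> n; split; near: n => //; exact: d_small.
have dSn : rho (iter n.+1 T x) (T (iter n.+1 T x)) <=
           rho (iter n T x) (iter n.+1 T x).
  apply: le_trans (kannan_displacement_contract _) _.
  by rewrite ler_piMl// ltW.
(* Displacements do not increase along the orbit, so a point whose displacement exceeds that of the
   [n]-th iterate is neither this iterate nor the next. *)
have far p : rho (iter n T x) (iter n.+1 T x) < rho p (T p) ->
    p <> iter n T x /\ p <> iter n.+1 T x.
  move=> lt_p; split=> pE; move: lt_p; rewrite pE; first by rewrite ltxx.
  by rewrite ltNge dSn.
have [nu1 nu2] := far nu dnu.
have [Tnu1 Tnu2] := far (T nu) dTnu.
have := crb_rect hX (nesym (@Tneq nu)) nu1 nu2 Tnu1 Tnu2 (nesym (@Tneq _)).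
have := hT (iter n T x) nu; rewrite -iterS -/D.
have := crb_theta_ge1 hX nu (T nu) (iter n T x) (iter n.+1 T x).
have := rho_ge0 (iter n T x) (iter n.+1 T x).
rewrite (crb_rhoC hX nu).
have := rho_ge0 (iter n T x) nu.
have := rho_ge0 (iter n.+1 T x) (T nu).
move: dn xn thn.
set t := theta _ _ _ _; set a := rho _ (iter _ _ _); set b := rho _ nu.
set c := rho _ (T nu) => dn xn thn c0 b0 a0 t1 c_le D_le.
have : D <= 3 / 2 * (b + a + c).
  apply: le_trans D_le _; apply: ler_wpM2r; last exact: ltW.
  by rewrite !addr_ge0.
have : k * (a + D) <= 1 / 2 * (a + D).
  by apply: ler_wpM2r; [rewrite addr_ge0// ltW | exact: ltW].
by lra.
Unshelve. all: by end_near. Qed.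

End KannanMap.

Theorem theorem2p2 (R : realType) (X : Type)
    (theta : X -> X -> X -> X -> R) (rho : X -> X -> R)
    (hX : controlled_rect_bmetric theta rho)
    (hcomplete : rho_complete rho)
    (T : X -> X) (k : R) (hk0 : 0 < k) (hk2 : k < 1 / 2)
    (hT : forall x y : X, rho (T x) (T y) <= k * (rho x (T x) + rho y (T y)))
    (hcvg1 : forall (x0 : X) (m : nat), (1 < m)%N ->
       cvgn (fun n : nat => theta (iter n T x0) (iter n.+1 T x0)
                                  (iter n.+2 T x0) (iter m T x0)))
    (hsup : forall x0 : X,
       (ereal_sup [set (limn (fun n : nat =>
                          theta (iter n T x0) (iter n.+1 T x0)
                                (iter n.+2 T x0) (iter m T x0)))%:E
                  | m in [set m : nat | (1 < m)%N]] <= (1 / k)%:E)%E)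
    (hcvg2 : forall x0 u v : X,
       cvgn (fun n : nat => theta u v (iter n T x0) (iter n.+1 T x0)))
    (hlim2 : forall x0 u v : X,
       limn (fun n : nat => theta u v (iter n T x0) (iter n.+1 T x0)) <= 1) :
  exists! x : X, T x = x.
Proof.
have [x0] := crb_nonempty hX.
have xC := kannan_orbit_double_lim0 hX hk0 hk2 hT x0.
have [nu [xnu _]] := hcomplete _ (ex_intro _ 0 xC).
(* Self-distance is zero, so the orbit of [T x0] converges to [nu] in the sense required with base
   point [T x0]. *)
move: xnu; rewrite (crb_rho_eq0 hX nu nu).2// => xnu.
have [z Tz] := kannan_orbit_limit_fixed hX hk0 hk2 hT hcvg2 hlim2 xnu.
exists z; split=> // y Ty; exact: kannan_fixpoint_unique hX hT _ _ Tz Ty.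
Qed.
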